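(* Let $m,n,q\in\mathbb{N}$ with $n\ge q+m-1$, and let $a_{(1);N},\ldots,a_{(m);N}$ be $m$ sequences of complex numbers defined for integers $N$ in $[q,n]$. Then $$\sum_{\sigma\in S_m}\ \sum_{q\le N_1<\cdots<N_m\le n}a_{(\sigma(m));N_m}\cdots a_{(\sigma(1));N_1}=\sum_{P\in\Omega}(-1)^{m-\sum_{i=1}^m y_i}\prod_{i=1}^{m}[(i-1)!]^{y_i}\left[\prod_{g=1}^{y_i}\left(\sum_{N=q}^{n}\ \prod_{h\in P_{i,g}}a_{(h);N}\right)\right].$$ Here, for each $P\in\Omega$, $y_i=y_i(P)$ is the number of blocks of $P$ of size $i$, and $P_{i,1},\ldots,P_{i,y_i}$ are the blocks of $P$ of size $i$.
   Context: $\mathbb{N}=\{0,1,2,\ldots\}$. $S_m$ is the group of permutations of $\{1,\ldots,m\}$. $\Omega$ is the set of all set partitions of $\{1,\ldots,m\}$, i.e. sets of non-empty disjoint subsets (blocks) whose union is $\{1,\ldots,m\}$. Empty products equal $1$. A multiple sum of order $0$ equals $1$. *)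

(* Defs.v *)
From mathcomp Require Import all_boot all_order all_algebra all_fingroup.
From mathcomp Require Import reals.
From mathcomp Require Import complex.

Set Implicit Arguments.
Unset Strict Implicit.
Unset Printing Implicit Defensive.

Import Order.TTheory GRing.Theory Num.Theory.

Local Open Scope ring_scope.

(* The index set {1, ..., m} is encoded as 'I_m = {0, ..., m - 1}; block sizes
   are not shifted. *)

(* N encodes a tuple of integers in [0, n]; the predicate says that
   q <= N_1 < ... < N_m. *)
Definition increasing_from (m n q : nat) (N : {ffun 'I_m -> 'I_n.+1}) : bool :=
  [forall i : 'I_m, (q <= N i)%N] &&
  [forall i : 'I_m, forall j : 'I_m, (i < j)%N ==> (N i < N j)%N].

Definition blocks_of_size (m : nat) (P : {set {set 'I_m}}) (i : nat) :
    {set {set 'I_m}} :=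
  [set B in P | #|B| == i].

Definition nb_blocks (m : nat) (P : {set {set 'I_m}}) (i : nat) : nat :=
  #|blocks_of_size P i|.

(* P_{i,1}, ..., P_{i,y_i}, listed in the order of the library's enumeration;
   g is 0-based. *)
Definition block (m : nat) (P : {set {set 'I_m}}) (i : nat)
    (g : 'I_(nb_blocks P i)) : {set 'I_m} :=
  enum_val g.

(* Main.v *)
Require Import Defs.
From mathcomp Require Import all_boot all_order all_algebra all_fingroup.
From mathcomp Require Import reals.
From mathcomp Require Import complex.

Set Implicit Arguments.
Unset Strict Implicit.
Unset Printing Implicit Defensive.

Import Order.TTheory GRing.Theory Num.Theory.

Local Open Scope ring_scope.

(** Both sides are sums over functions f from 'I_m to [q, n] of the monomial
    \prod_i a i (f i), and they give every f the same coefficient.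

    On the left, a pair (permutation, increasing tuple) is the same thing as an
    injective f: an injective f is made increasing by exactly one reordering of
    its arguments, the one that sorts them by value ([card_sorting_perms]).  So
    each injective f is counted once and no other f occurs.

    On the right, expanding the product over the blocks of a partition P
    chooses one value per block, that is, a function f constant on the blocks
    of P ([prod_blocks_sum]).  Write w(k) = (-1)^(k-1) (k-1)!.  The coefficient
    of f is then the sum of \prod_(B in P) w(#|B|) over the partitions P on
    whose blocks f is constant, and it must be shown to be 1 or 0 according to
    whether f is injective.  This is the defining property of the Moebius
    function of the partition lattice.  [sum_partition_injective] proves it by
    induction on the set A being partitioned, splitting off the block B of a
    chosen point x.  By induction the rest contributes 1 if f is injective on
    A \ B and 0 otherwise.  Let F be the fibre of f through x, with k elements.
    Then B is contained in F, and injectivity outside B leaves only B = F and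
    B = F \ {y}, with y in F and y <> x.  These contribute
    w(k) + (k - 1) w(k - 1), which vanishes for k > 1 and is 1 for k = 1
    ([sum_first_block]).

    Grouping the blocks of P by size turns \prod_(B in P) w(#|B|) into the sign
    and the factorials of the statement. *)

(** * The Moebius identity for set partitions *)

Definition constant_on (T : finType) (V : eqType) (f : T -> V) (B : {set T}) :=
  [forall x in B, forall y in B, f x == f y].

Lemma constant_onP (T : finType) (V : eqType) (f : T -> V) (B : {set T}) :
  reflect {in B &, forall x y, f x = f y} (constant_on f B).
Proof.
apply: (iffP 'forall_in_forall_inP) => H x y; first by move=> xB yB; apply/eqP/H.
by move=> yB Hy; apply/eqP; apply: H.
Qed.

(** The value of the Moebius function of the lattice of partitions of k points
    between the finest and the coarsest partition; up to sign, the number of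
    k-cycles. *)
Definition block_weight (R : comNzRingType) (k : nat) : R :=
  (-1) ^+ k.-1 * (k.-1)`!%:R.

Lemma block_weightS (R : comNzRingType) (k : nat) :
  (0 < k)%N -> block_weight R k.+1 = - (k%:R * block_weight R k).
Proof.
case: k => // k _; rewrite /block_weight /= exprS factS natrM.
by rewrite mulN1r mulNr mulrCA.
Qed.

Lemma partition_block_sub (T : finType) (P : {set {set T}}) (A B : {set T}) :
  partition P A -> B \in P -> B \subset A.
Proof. by move=> /cover_partition <- BP; apply: bigcup_sup. Qed.

(** A partition of A amounts to the block B containing x together with a
    partition of the complement of B, so weighted sums over partitions satisfy
    a recursion. *)
Lemma sum_partition_pblock (R : comNzRingType) (T : finType)
    (g : {set T} -> R) (A : {set T}) (x : T) : x \in A ->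
  \sum_(P : {set {set T}} | partition P A) \prod_(B in P) g B =
  \sum_(B : {set T} | (x \in B) && (B \subset A))
     g B * \sum_(P : {set {set T}} | partition P (A :\: B)) \prod_(C in P) g C.
Proof.
move=> xA.
have xcover P : partition P A -> x \in cover P by move/cover_partition->.
rewrite (partition_big (fun P => pblock P x)
  (fun B : {set T} => (x \in B) && (B \subset A))) /=; last first.
  move=> P PA; rewrite mem_pblock xcover //=.
  by rewrite (partition_block_sub PA) // pblock_mem // xcover.
apply: eq_bigr => B /andP[xB BA].
have B0 : B != set0 by apply/set0Pn; exists x.
rewrite (reindex_onto (fun P => B |: P) (fun P => P :\ B)) /=; last first.
  by move=> P /andP[PA /eqP <-]; rewrite setD1K // pblock_mem // xcover.
rewrite big_distrr /=.
have notin P : partition P (A :\: B) -> B \notin P.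
  move=> PA; apply/negP => /(partition_block_sub PA) /subsetP /(_ x xB).
  by rewrite inE xB.
have PE P : [&& partition (B |: P) A && (pblock (B |: P) x == B)
    & (B |: P) :\ B == P] = partition P (A :\: B).
  apply/idP/idP => [/andP[/andP[PA _] /eqP PBK]|PA].
    by rewrite -PBK; apply: partitionD1; rewrite // setU11.
  have QA : partition (B |: P) A.
    have := partitionU1 PA B0; rewrite setDE setUIr setUCr setIT.
    rewrite (setUidPr BA); apply.
    by rewrite disjoints_subset setCI setCK subsetUr.
  rewrite QA setU1K ?notin // eqxx andbT /=; apply/eqP.
  by apply: def_pblock; rewrite ?setU11 //; case/and3P: QA.
by rewrite (eq_bigl _ _ PE); apply: eq_bigr => P PA; rewrite big_setU1 //= notin.
Qed.

(** Only two kinds of blocks survive.  With F the fibre of f through x, a block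
    B on which f is constant lies in F, and f is not injective on A \ B as soon
    as B misses two points of F.  The block F and the blocks F \ {y} cancel each
    other by [block_weightS], except when F = {x}. *)
Lemma sum_first_block (R : comNzRingType) (T : finType) (V : eqType)
    (f : T -> V) (A : {set T}) (x : T) : x \in A ->
  \sum_(B : {set T} | (x \in B) && (B \subset A))
     (block_weight R #|B| *+ constant_on f B) * (dinjectiveb f (A :\: B))%:R
  = (dinjectiveb f A)%:R.
Proof.
move=> xA; pose F := [set y in A | f y == f x].
have xF : x \in F by rewrite !inE xA eqxx.
have FA : F \subset A by apply/subsetP => y; rewrite inE => /andP[].
have Fsat u v : v \in A -> f u = f v -> u \in F -> v \in F.
  by move=> vA fuv; rewrite !inE fuv vA => /andP[].
have Fconst : constant_on f F.
  by apply/constant_onP => u v; rewrite !inE => /andP[_ /eqP->] /andP[_ /eqP->].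
have constF (B : {set T}) : x \in B -> B \subset A -> constant_on f B -> B \subset F.
  move=> xB /subsetP BA /constant_onP Bc; apply/subsetP => y yB.
  by rewrite inE BA //= (Bc _ _ yB xB).
have subconst (B : {set T}) : B \subset F -> constant_on f B.
  move=> /subsetP BF; apply/constant_onP => u v uB vB.
  by move/constant_onP: Fconst; apply; apply: BF.
have subinj (C D : {set T}) : C \subset D -> dinjectiveb f D -> dinjectiveb f C.
  by move=> /subsetP CD /dinjectiveP Di; apply/dinjectiveP => u v uC vC;
     apply: Di; apply: CD.
(* If f already has a collision outside F, every term vanishes: when f is
   constant on B, the set A \ B contains A \ F. *)
have [Finj|nFinj] := boolP (dinjectiveb f (A :\: F)); last first.
  have -> : dinjectiveb f A = false.
    by apply: contraNF nFinj; apply: subinj; rewrite subsetDl.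
  apply: big1 => B /andP[xB BA].
  case: (boolP (constant_on _ _)) => [Bc|_]; last first.
    by rewrite mulr0n mul0r.
  rewrite (_ : dinjectiveb _ _ = false) ?mulr0 //.
  by apply: contraNF nFinj; apply: subinj; apply/setDS/constF.
have minus1 y : y \in F -> dinjectiveb f (A :\: (F :\ y)).
  move=> yF; apply/dinjectiveP => u v; rewrite !in_setD !in_set1.
  rewrite !negb_and !negbK => /andP[uy uA] /andP[vy vA] fuv.
  have [uF|uF] := boolP (u \in F).
    have vF := Fsat _ _ vA fuv uF.
    by move: uy vy; rewrite uF vF !orbF => /eqP-> /eqP->.
  have vF : v \notin F by apply: contra uF; apply: Fsat.
  by move/dinjectiveP: Finj; apply; rewrite // in_setD ?uF ?vF.
(* The term of F is separated from the terms of the sets F \ {y}, collected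
   in S; all the other terms vanish. *)
rewrite (bigD1 F) /=; last by rewrite xF FA.
rewrite Fconst Finj mulr1 mulr1n.
pose S : {set {set T}} := [set F :\ y | y in F :\ x].
rewrite (bigID (fun B : {set T} => B \in S)) /=.
rewrite [X in _ + (_ + X)]big1 ?addr0; last first.
  move=> B /andP[/andP[/andP[xB BA] BF] BS].
  case: (boolP (constant_on _ _)) => [Bc|_]; last by rewrite mulr0n mul0r.
  rewrite (_ : dinjectiveb _ _ = false) ?mulr0 //.
  have sBF := constF _ xB BA Bc; apply: contraNF BS => /dinjectiveP Binj.
  have /properP[_ [y yF yB]] : B \proper F by rewrite properEneq BF.
  apply/imsetP; exists y.
    by rewrite in_setD1 yF andbT; apply: contraNneq yB => ->.
  apply/setP => u; rewrite in_setD in_set1.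
  have [->|uy] /= := eqVneq u y; first exact/negbTE.
  apply/idP/idP => [|uF]; first exact: (subsetP sBF).
  apply: contraTT uy => uB; apply/negPn/eqP.
  apply: Binj; rewrite ?in_setD ?uB ?yB ?(subsetP FA) //.
  by move/constant_onP: Fconst; apply.
have -> : \sum_(B : {set T} | ((x \in B) && (B \subset A) && (B != F)) && (B \in S))
     (block_weight R #|B| *+ constant_on f B) * (dinjectiveb f (A :\: B))%:R
   = \sum_(y in F :\ x) block_weight R #|F|.-1.
  rewrite (eq_bigl (fun B : {set T} => B \in S)); last first.
    move=> B; rewrite /= andbC; case: imsetP => //= -[y].
    rewrite in_setD in_set1 => /andP[yx yF] ->.
    rewrite in_setD in_set1 eq_sym yx xF /= (subset_trans (subsetDl _ _) FA) /=.
    by apply: contraTneq yF => <-; rewrite !inE eqxx.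
  rewrite big_imset /=; last first.
    move=> u v /setD1P[_ uF] _ /setP/(_ u).
    rewrite !in_setD !in_set1 eqxx uF !andbT /=.
    by move=> uv; apply/eqP; rewrite -[_ == _]negbK -uv.
  apply: eq_bigr => y /setD1P[_ yF].
  rewrite minus1 // subconst ?subsetDl // mulr1 mulr1n.
  by rewrite (cardsD1 y F) yF.
(* Now f is injective outside F, so its injectivity on A only depends on
   whether F is a singleton. *)
rewrite sumr_const.
have -> : dinjectiveb f A = (#|F :\ x| == 0)%N.
  apply/idP/idP => [/dinjectiveP Ainj|].
    rewrite cards_eq0 -subset0; apply/subsetP => y; rewrite !inE.
    by case/and3P => yx yA /eqP/(Ainj _ _ yA xA)/eqP; rewrite (negPf yx).
  rewrite cards_eq0 => /eqP F0; have := minus1 x xF.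
  by rewrite F0 setD0.
rewrite (cardsD1 x F) xF add1n /=.
have [->|k0] := posnP #|F :\ x|.
  by rewrite mulr0n addr0 /block_weight mul1r.
by rewrite block_weightS // mulr_natl addNr.
Qed.

Lemma sum_partition_injective (R : comNzRingType) (T : finType) (V : eqType)
    (f : T -> V) (A : {set T}) :
  \sum_(P : {set {set T}} | partition P A)
     \prod_(B in P) (block_weight R #|B| *+ constant_on f B)
  = (dinjectiveb f A)%:R.
Proof.
have [k] := ubnP #|A|; elim: k A => // k IHk A; rewrite ltnS => Ak.
have [->|[x xA]] := set_0Vmem A.
  rewrite (big_pred1 set0) => [|P]; last by rewrite partition_set0.
  rewrite big_set0 (_ : dinjectiveb _ _) //.
  by apply/dinjectiveP => u v; rewrite inE.
rewrite (sum_partition_pblock _ xA) -(sum_first_block R f xA).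
apply: eq_bigr => B /andP[xB BA]; rewrite IHk //.
apply: leq_trans Ak; apply: proper_card; rewrite properE subsetDl.
by apply/subsetPn; exists x; rewrite // in_setD xB.
Qed.

(** * Expanding a product over blocks *)

(** Expanding the product picks a value for each block; composing with
    [pblock P] identifies such choices with the functions constant on blocks.
    In the opposite direction the value is read off at a point of the block,
    and [v0] is the conventional value at the sets that are not blocks. *)
Lemma prod_blocks_sum (R : comNzRingType) (T V : finType) (v0 : V)
    (Q : pred V) (a : T -> V -> R) (P : {set {set T}}) :
  partition P [set: T] ->
  \prod_(B in P) \sum_(v | Q v) \prod_(h in B) a h v =
  \sum_(f : {ffun T -> V} | [forall i, Q (f i)])
     (\prod_(B in P) (constant_on f B)%:R) * \prod_i a i (f i).
Proof.
move=> PT; have trivP : trivIset P by case/and3P: PT.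
have xcover x : x \in cover P by rewrite (cover_partition PT) inE.
have prodT (F : T -> R) : \prod_i F i = \prod_(B in P) \prod_(h in B) F h.
  by rewrite -(set_partition_big _ PT); apply: eq_bigl => i; rewrite inE.
pose on_blocks (f : {ffun T -> V}) : {ffun {set T} -> V} :=
  [ffun B : {set T} => if [pick x in B | B \in P] is Some x then f x else v0].
pose on_points (F : {ffun {set T} -> V}) : {ffun T -> V} :=
  [ffun x => F (pblock P x)].
have on_blocksE f (B : {set T}) : B \in P ->
    exists2 x, x \in B & on_blocks f B = f x.
  move=> BP; rewrite ffunE; case: pickP => [x /andP[xB _]|B0]; first by exists x.
  have /set0Pn[x xB] := partition_neq0 PT BP.
  by have := B0 x; rewrite /= xB BP.
rewrite (big_distr_big_dep v0).
rewrite (reindex_onto on_blocks on_points) /=; last first.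
  move=> F /pfamilyP[/subsetP Fsupp _]; apply/ffunP => B.
  have [BP|BP] := boolP (B \in P).
    have [x xB ->] := on_blocksE (on_points F) B BP.
    by rewrite ffunE (def_pblock trivP BP xB).
  rewrite ffunE; case: pickP => [x|_]; first by rewrite /= (negPf BP) andbF.
  by apply/esym/eqP; apply: contraNT BP => /Fsupp.
have predE f : (on_blocks f \in pfamily v0 (mem P) (fun=> Q))
    && (on_points (on_blocks f) == f)
  = [forall i, Q (f i)] && [forall B in P, constant_on f B].
  apply/andP/andP => [[/pfamilyP[_ fQ] /eqP fE]|[/forallP fQ /forall_inP fc]].
    have fpt i : f i = on_blocks f (pblock P i) by rewrite -{1}fE ffunE.
    split; first by apply/forallP => i; rewrite fpt; apply/fQ/pblock_mem.
    apply/forall_inP => B BP; apply/constant_onP => x y xB yB.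
    by rewrite !fpt !(def_pblock trivP BP).
  split.
    apply/pfamilyP; split.
      apply/subsetP => B; rewrite inE ffunE; case: pickP => [x /andP[]//|_].
      by rewrite eqxx.
    by move=> B BP; have [x _ ->] := on_blocksE f B BP; apply: fQ.
  apply/eqP/ffunP => x; rewrite ffunE.
  have xP := pblock_mem (xcover x).
  have [y yx ->] := on_blocksE f _ xP.
  by move/constant_onP: (fc _ xP); apply; rewrite ?mem_pblock.
rewrite (eq_bigl _ _ predE) big_mkcondr /=; apply: eq_bigr => f _.
case: ifP => [/forall_inP fc|/negbT].
  rewrite [X in _ = X * _]big1 ?mul1r => [|B /fc -> //].
  rewrite prodT; apply: eq_bigr => B BP; apply: eq_bigr => h hB.
  have [x xB ->] := on_blocksE f B BP.
  by congr (a h _); move/constant_onP: (fc _ BP); apply.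
rewrite negb_forall_in => /exists_inP[B BP /negPf fB].
by rewrite (bigD1 B) //= fB !mul0r.
Qed.

Lemma sum_partition_power_sums (R : comNzRingType) (T V : finType) (v0 : V)
    (Q : pred V) (a : T -> V -> R) :
  \sum_(P : {set {set T}} | partition P [set: T])
     \prod_(B in P)
        (block_weight R #|B| * \sum_(v | Q v) \prod_(h in B) a h v) =
  \sum_(f : {ffun T -> V} | injectiveb f && [forall i, Q (f i)])
     \prod_i a i (f i).
Proof.
under eq_bigr => P PT do rewrite big_split /= (prod_blocks_sum v0) // big_distrr.
rewrite exchange_big /= [RHS]big_mkcondl; apply: eq_bigr => f _.
under eq_bigr => P PT do rewrite mulrA -big_split /=.
rewrite -big_distrl /=.
under eq_bigr => P PT do under eq_bigr => B BP do rewrite mulr_natr.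
rewrite sum_partition_injective.
have -> : dinjectiveb f [set: T] = injectiveb f.
  by apply/dinjectiveP/injectiveP => fi x y *; apply: fi; rewrite ?inE.
by case: injectiveb; rewrite ?mul1r ?mul0r.
Qed.

(** * Sorting injective functions *)

Lemma card_lt_ord (m : nat) (i : 'I_m) : #|[set j : 'I_m | (j < i)%N]| = i.
Proof.
by rewrite -sum1dep_card (big_ord_narrow (ltnW (ltn_ord i))) sum1_card card_ord.
Qed.

(** If f o s is increasing, the inverse of s must send j to the number of k with
    f k < f j, which leaves at most one s; for injective f this rank function
    is a permutation and its inverse does sort f. *)
Lemma card_sorting_perms (m : nat) (f : 'I_m -> nat) :
  #|[set s : 'S_m | [forall i : 'I_m, forall j : 'I_m,
       (i < j)%N ==> (f (s i) < f (s j))%N]]| = injectiveb f.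
Proof.
pose rank j := #|[set k | (f k < f j)%N]|.
have sortP (s : 'S_m) : reflect {homo f \o s : i j / (i < j)%N}
    [forall i : 'I_m, forall j : 'I_m, (i < j)%N ==> (f (s i) < f (s j))%N].
  by apply: (iffP 'forall_'forall_implyP) => H i j; apply: H.
have rank_sorted (s : 'S_m) : {homo f \o s : i j / (i < j)%N} ->
    forall i, rank (s i) = i.
  move=> s_sorted i; rewrite -[RHS]card_lt_ord /rank.
  rewrite -[RHS](card_imset _ (@perm_inj _ s)); apply: eq_card => k.
  rewrite inE -[k](permKV s) mem_imset ?inE; last exact: perm_inj.
  move: (s^-1 k)%g => j.
  have [ji|ij|/ord_inj ->] := ltngtP j i; last by rewrite ltnn.
    exact: (s_sorted _ _ ji).
  by apply/negbTE; rewrite -leqNgt; apply/ltnW/(s_sorted _ _ ij).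
have [/injectiveP finj|fninj] := boolP (injectiveb f); last first.
  apply/eqP; rewrite cards_eq0 -subset0; apply/subsetP => s; rewrite !inE.
  move=> /sortP s_sorted; case/negP: fninj; apply/injectiveP => x y.
  rewrite -[x](permKV s) -[y](permKV s) => fxy.
  by case: (ltngtP (s^-1 x)%g (s^-1 y)%g) => [/s_sorted|/s_sorted|/ord_inj -> //];
     rewrite /= fxy ltnn.
have rank_lt j : (rank j < m)%N.
  rewrite -[X in (_ < X)%N]card_ord; apply: proper_card; apply/properP.
  by split; [apply/subsetP | exists j; rewrite ?inE ?ltnn].
have rank_mono i j : (f i <= f j)%N -> (rank i <= rank j)%N.
  move=> fij; apply/subset_leq_card/subsetP => k; rewrite !inE => fki.
  exact: leq_trans fki fij.
have rank_smono i j : (f i < f j)%N -> (rank i < rank j)%N.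
  move=> fij; apply: proper_card; apply/properP; split.
    by apply/subsetP => k; rewrite !inE => /ltn_trans; apply.
  by exists i; rewrite !inE ?ltnn.
have rank_inj : injective (fun j => Ordinal (rank_lt j)).
  move=> i j [rij]; apply: finj.
  by case: (ltngtP (f i) (f j)) => // /rank_smono; rewrite rij ltnn.
pose s0 : 'S_m := (perm rank_inj)^-1%g.
have rank_s0 i : rank (s0 i) = i.
  by have /(congr1 val) := permKV (perm rank_inj) i; rewrite permE.
apply/eqP/cards1P; exists s0; apply/setP => s; rewrite !inE.
apply/sortP/eqP => [s_sorted|-> i j ij].
  apply/permP => i; apply: (@perm_inj _ (perm rank_inj)); apply/val_inj.
  by rewrite permKV permE /= rank_sorted.
by rewrite /= ltnNge; apply: contraL ij => /rank_mono; rewrite !rank_s0 -leqNgt.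
Qed.

(** Substitute N = f o s for fixed s, exchange the sums, and count the s that
    sort f. *)
Lemma sum_perms_increasing (R : comNzRingType) (m n q : nat)
    (a : 'I_m -> 'I_n.+1 -> R) :
  \sum_(s : 'S_m) \sum_(N : {ffun 'I_m -> 'I_n.+1} | increasing_from q N)
     \prod_(i < m) a (s i) (N i) =
  \sum_(f : {ffun 'I_m -> 'I_n.+1} | injectiveb f && [forall i, (q <= f i)%N])
     \prod_(i < m) a i (f i).
Proof.
pose tr (s : 'S_m) (f : {ffun 'I_m -> 'I_n.+1}) : {ffun 'I_m -> 'I_n.+1} :=
  [ffun i => f (s i)].
have trV (s : 'S_m) f : tr s^-1%g (tr s f) = f.
  by apply/ffunP => i; rewrite !ffunE permKV.
have trE s f : increasing_from q (tr s f) = [forall i, (q <= f i)%N] &&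
    [forall i : 'I_m, forall j : 'I_m, (i < j)%N ==> (f (s i) < f (s j))%N].
  congr (_ && _); last first.
    by apply: eq_forallb => i; apply: eq_forallb => j; rewrite !ffunE.
  apply/forallP/forallP => qf i; last by rewrite ffunE.
  by have := qf (s^-1 i)%g; rewrite ffunE permKV.
have termE (s : 'S_m) : \sum_(N : {ffun 'I_m -> 'I_n.+1} | increasing_from q N)
     \prod_(i < m) a (s i) (N i) =
   \sum_(f : {ffun 'I_m -> 'I_n.+1} | [forall i, (q <= f i)%N] &&
      [forall i : 'I_m, forall j : 'I_m, (i < j)%N ==> (f (s i) < f (s j))%N])
     \prod_(i < m) a i (f i).
  rewrite (reindex_onto (tr s) (tr s^-1%g)) /=; last first.
    by move=> N _; rewrite -{1}[s]invgK trV.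
  apply: eq_big => [f|f _]; first by rewrite trV eqxx andbT trE.
  rewrite [RHS](reindex_inj (@perm_inj _ s)).
  by apply: eq_bigr => i _; rewrite ffunE.
under eq_bigr => s _ do rewrite termE.
rewrite (exchange_big_dep (fun f : {ffun 'I_m -> 'I_n.+1} =>
   [forall i, (q <= f i)%N])) /=; last by move=> s f _ /andP[].
rewrite [RHS]big_mkcondl; apply: eq_bigr => f qf.
rewrite sumr_const.
rewrite (_ : #|_| = injectiveb f); first by case: injectiveb.
have -> : injectiveb f = injectiveb (fun i => f i : nat).
  apply/injectiveP/injectiveP => fi i j fij; apply: fi; first exact: ord_inj.
  by rewrite fij.
rewrite -card_sorting_perms; apply: eq_card => s.
by rewrite !inE -topredE /= qf.
Qed.

(** * Grouping blocks by size *)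

Lemma big_blocks_by_size (R : Type) (idx : R) (op : Monoid.com_law idx)
    (m : nat) (G : {set 'I_m} -> R) (P : {set {set 'I_m}}) :
  partition P [set: 'I_m] ->
  \big[op/idx]_(B in P) G B =
  \big[op/idx]_(1 <= i < m.+1) \big[op/idx]_(g < nb_blocks P i) G (block g).
Proof.
move=> PT; symmetry.
have sizeE i : \big[op/idx]_(g < nb_blocks P i) G (block g) =
    \big[op/idx]_(B in P) (if #|B| == i then G B else idx).
  rewrite -big_mkcondr; transitivity (\big[op/idx]_(B in blocks_of_size P i) G B).
    by rewrite big_enum_val.
  by apply: eq_bigl => B; rewrite inE.
under eq_bigr => i _ do rewrite sizeE.
rewrite exchange_big /=; apply: eq_bigr => B BP.
rewrite -big_mkcond /= (eq_bigl (fun i => i == #|B|)); last first.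
  by move=> i; rewrite eq_sym.
rewrite big_nat1_eq card_gt0 (partition_neq0 PT BP) ltnS /=.
by rewrite -[X in (_ <= X)%N](card_ord m) max_card.
Qed.

Lemma sum_nb_blocks (m : nat) (P : {set {set 'I_m}}) :
  partition P [set: 'I_m] ->
  (\sum_(1 <= i < m.+1) nb_blocks P i)%N = #|P|.
Proof.
move=> PT; rewrite -sum1_card (big_blocks_by_size _ _ PT).
by apply: eq_bigr => i _; rewrite sum_nat_const card_ord muln1.
Qed.

(** This matches the product of the signs of the block weights with the single
    global sign (-1)^(m - #|P|). *)
Lemma sum_card_block_pred (T : finType) (P : {set {set T}}) (A : {set T}) :
  partition P A -> (\sum_(B in P) #|B|.-1)%N = (#|A| - #|P|)%N.
Proof.
move=> PA; rewrite (card_partition PA).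
rewrite [X in (X - _)%N](_ : _ = (\sum_(B in P) #|B|.-1 + #|P|)%N) ?addnK //.
rewrite -sum1_card -big_split /=; apply: eq_bigr => B BP.
by rewrite addn1 prednK // card_gt0 (partition_neq0 PA BP).
Qed.

(** * The multiple sum identity *)

Theorem theorem3p2 (R : realType) (m n q : nat) (hn : (q + m <= n + 1)%N)
    (a : 'I_m -> nat -> R[i]) :
  \sum_(s : 'S_m)
     \sum_(N : {ffun 'I_m -> 'I_n.+1} | increasing_from q N)
        \prod_(i < m) a (s i) (N i)
  = \sum_(P : {set {set 'I_m}} | partition P [set: 'I_m])
      (-1) ^+ (m - \sum_(1 <= i < m.+1) nb_blocks P i) *
      \prod_(1 <= i < m.+1)
        (((i - 1)`!)%:R ^+ nb_blocks P i *
         \prod_(g < nb_blocks P i)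
            \sum_(q <= N < n.+1) \prod_(h in block g) a h N).
Proof.
rewrite (sum_perms_increasing q (fun i (v : 'I_n.+1) => a i v)).
apply: etrans (esym (sum_partition_power_sums ord0
  (fun v : 'I_n.+1 => (q <= v)%N) (fun i v => a i v))) _.
apply: eq_bigr => P PT.
under eq_bigr => B _ do rewrite -mulrA.
rewrite big_split /= prodrXr (sum_card_block_pred PT) cardsT card_ord.
rewrite (sum_nb_blocks PT); congr (_ * _).
rewrite (big_blocks_by_size _ _ PT); apply: eq_bigr => i _.
rewrite big_split /=; congr (_ * _).
  rewrite -[in RHS](card_ord (nb_blocks P i)) -prodr_const.
  apply: eq_bigr => g _; rewrite subn1.
  by have := enum_valP g; rewrite inE => /andP[_ /eqP ->].
by apply: eq_bigr => g _; rewrite big_geq_mkord.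
Qed.
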